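(* The assignment $\mathrm{OP}$ that sends each precomposition $\sigma$ to the operad $\mathrm{OP}(\sigma)$, and each precomposition morphism $\phi:\sigma\to\tau$ to the map $\phi^{\mathrm{OP}}:\mathrm{OP}(\sigma)\to\mathrm{OP}(\tau)$ given by $\phi^{\mathrm{OP}}(a_s^{(n)})=a^{(n)}_{\phi(s)}$, is a functor from the category of precompositions to the category of operads. (In particular each $\phi^{\mathrm{OP}}$ is an operad morphism.)
   Context: Operads: a (nonsymmetric, set) operad is a graded set $P=\bigsqcup_{n\geq1}P_n$ with maps $\circ_i:P_n\times P_m\to P_{n+m-1}$ ($1\leq i\leq n$) and a unit $\mathbf 1\in P_1$ such that for $p_1\in P_n,p_2\in P_m,p_3\in P_p$: $(p_1\circ_ip_2)\circ_{j+m-1}p_3=(p_1\circ_jp_3)\circ_ip_2$ for $1\leq i<j\leq n$; $(p_1\circ_ip_2)\circ_{i+j-1}p_3=p_1\circ_i(p_2\circ_jp_3)$ for $1\leq i\leq n$, $1\leq j\leq m$; $p_1\circ_i\mathbf 1=p_1=\mathbf 1\circ_1p_1$. Operad morphisms are arity-preserving maps preserving the unit and all partial compositions. Precompositions: let $\square$ be the monoid with generators $b_{i,n}$ ($i\in\mathbb Z$, $n\geq1$) and relations: $b_{i,n}=b_{0,n}$ for $i<0$; $b_{i,1}=1$ for all $i$; $b_{i,n}b_{j,m}=b_{j+n-1,m}b_{i,n}$ if $i\leq j$ or $i,j\leq0$; $b_{i+j,n}b_{i,m}=b_{i,n+m-1}$ if $0\leq j<m$. A filtered commutative monoid is a commutative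 monoid $(\mathcal S,\oplus)$ with unit $\mathbf 0_{\mathcal S}$ and submonoids $\mathcal S_1\subseteq\mathcal S_2\subseteq\cdots$ with $\mathcal S=\bigcup_n\mathcal S_n$. A precomposition on it is a monoid morphism from $\square$ to the monoid of monoid endomorphisms of $\mathcal S$ (under composition) such that, writing $\sigma^{i,n}$ for the image of $b_{i,n}$: $\sigma^{i,n}(\mathcal S_m)\subseteq\mathcal S_{n+m-1}$, and $\sigma^{i,n}(s)=s$ for $s\in\mathcal S_m$ whenever $i\geq m+1$. A precomposition morphism from $\sigma$ (on $\mathcal S$) to $\tau$ (on $\mathcal S'$) is a monoid morphism $\phi:\mathcal S\to\mathcal S'$ with $\phi(\mathcal S_n)\subseteq\mathcal S'_n$ for all $n$ and $\tau^{i,n}(\phi(s))=\phi(\sigma^{i,n}(s))$ for all $i,n,s$. Precompositions with these morphisms form a category. The operad $\mathrm{OP}(\sigma)$: its elements of arity $n$ are the symbols $a_s^{(n)}$, $s\in\mathcal S_n$, with $a_s^{(n)}\circ_ia_{s'}^{(m)}=a^{(n+m-1)}_{\sigma^{i,m}(s)\oplus\sigma^{0,i}(s')}$ for $1\leq i\leq n$ and unit $a^{(1)}_{\mathbf 0_{\mathcal S}}$. *)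

(* Defs.v *)
From HB Require Import structures.
From mathcomp Require Import all_boot all_order all_algebra.
From mathcomp Require Import boolp.

Set Implicit Arguments.
Unset Strict Implicit.
Unset Printing Implicit Defensive.

Import GRing.Theory.
Local Open Scope quotient_scope.

Record category := Category {
  obj :> Type;
  hom : obj -> obj -> Type;
  idm : forall a, hom a a;
  compm : forall a b c, hom b c -> hom a b -> hom a c;
  compm1 : forall a b (f : hom a b), compm f (idm a) = f;
  comp1m : forall a b (f : hom a b), compm (idm b) f = f;
  compmA : forall a b c d (f : hom c d) (g : hom b c) (h : hom a b),
    compm f (compm g h) = compm (compm f g) h }.

Arguments hom {_} _ _.
Arguments idm {_} _.
Arguments compm {_ _ _ _} _ _.

Definition is_functor (C D : category) (F : C -> D)
    (Fm : forall a b : C, hom a b -> hom (F a) (F b)) : Prop :=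
  (forall a : C, Fm a a (idm a) = idm (F a)) /\
  (forall (a b c : C) (f : hom b c) (g : hom a b),
     Fm a c (compm f g) = compm (Fm b c f) (Fm a b g)).

(* The graded set is given by its total space together with the arity map, so
   that associativity needs no transport along equalities between arities.
   Input positions are numbered from 1; [pcomp p i q _] is p o_i q. *)
Record operad_data := OperadData {
  elts :> Type;
  arity : elts -> nat;
  opunit : elts;
  pcomp : forall (p : elts) (i : nat) (q : elts), 0 < i <= arity p -> elts }.

Arguments arity {o} p.
Arguments opunit {o}.
Arguments pcomp {o} p i q _.

(* Position bounds on inner composites are quantified universally: they are
   provable from [arity_pcomp], and proofs of them are unique. *)
Record is_operad (P : operad_data) : Prop := IsOperad {
  arity_gt0 : forall p : P, 0 < arity p;
  arity_unit : arity (@opunit P) = 1;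
  arity_pcomp : forall (p q : P) i (Hi : 0 < i <= arity p),
    arity (pcomp p i q Hi) = arity p + arity q - 1;
  pcomp_par : forall (p1 p2 p3 : P) i j
      (Hi : 0 < i <= arity p1) (Hj : 0 < j <= arity p1), i < j ->
    forall (Hj' : 0 < j + arity p2 - 1 <= arity (pcomp p1 i p2 Hi))
           (Hi' : 0 < i <= arity (pcomp p1 j p3 Hj)),
    pcomp (pcomp p1 i p2 Hi) (j + arity p2 - 1) p3 Hj'
      = pcomp (pcomp p1 j p3 Hj) i p2 Hi';
  pcomp_seq : forall (p1 p2 p3 : P) i j
      (Hi : 0 < i <= arity p1) (Hj : 0 < j <= arity p2)
      (Hij : 0 < i + j - 1 <= arity (pcomp p1 i p2 Hi)),
    pcomp (pcomp p1 i p2 Hi) (i + j - 1) p3 Hij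
      = pcomp p1 i (pcomp p2 j p3 Hj) Hi;
  pcomp1r : forall (p : P) i (Hi : 0 < i <= arity p), pcomp p i opunit Hi = p;
  pcomp1l : forall (p : P) (H : 0 < 1 <= arity (@opunit P)),
    pcomp opunit 1 p H = p }.

Record operad := Operad {
  operad_sort :> operad_data;
  operadP : is_operad operad_sort }.

Record is_operad_morphism (P Q : operad_data) (f : P -> Q) : Prop :=
  IsOperadMorphism {
    omor_arity : forall p, arity (f p) = arity p;
    omor_unit : f opunit = opunit;
    omor_pcomp : forall (p q : P) i
        (Hi : 0 < i <= arity p) (Hi' : 0 < i <= arity (f p)),
      f (pcomp p i q Hi) = pcomp (f p) i (f q) Hi' }.

Record operad_morphism (P Q : operad) := OperadMorphism {
  omor_fun :> P -> Q;
  omorP : is_operad_morphism omor_fun }.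

Lemma operad_morphism_eq (P Q : operad) (f g : operad_morphism P Q) :
  f =1 g -> f = g.
Proof.
case: f g => [f Hf] [g Hg] /= /funext E.
by subst g; rewrite (Prop_irrelevance Hf Hg).
Qed.

Lemma omor_id_subproof (P : operad) : is_operad_morphism (fun p : P => p).
Proof. by split=> // p q i Hi Hi'; rewrite (Prop_irrelevance Hi Hi'). Qed.

Lemma omor_comp_subproof (P Q R : operad)
    (f : operad_morphism Q R) (g : operad_morphism P Q) :
  is_operad_morphism (fun p => f (g p)).
Proof.
case: f g => [f [fa fu fc]] [g [ga gu gc]] /=; split=> [p||p q i Hi Hi'].
- by rewrite fa ga.
- by rewrite gu fu.
- have Hg : 0 < i <= arity (g p) by rewrite ga.
  by rewrite (gc _ _ _ Hi Hg) (fc _ _ _ Hg Hi').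
Qed.

Definition omor_id (P : operad) : operad_morphism P P :=
  OperadMorphism (omor_id_subproof P).
Definition omor_comp (P Q R : operad)
    (f : operad_morphism Q R) (g : operad_morphism P Q) : operad_morphism P R :=
  OperadMorphism (omor_comp_subproof f g).

Definition operadCat : category.
Proof.
by refine (@Category operad operad_morphism omor_id omor_comp _ _ _);
  move=> *; apply: operad_morphism_eq.
Defined.

(* The letter (i, k) stands for the generator b_{i,k+1}, so that words are
   exactly the elements of the free monoid on the b_{i,n} with n >= 1. *)
Definition word := seq (int * nat).

Definition letter (i : int) (n : nat) : word := [:: (i, n.-1)].

Inductive box_rel : word -> word -> Prop :=
| BoxNeg (i : int) n : 0 < n -> (i < 0)%R ->
    box_rel (letter i n) (letter 0 n)
| BoxOne (i : int) : box_rel (letter i 1) [::]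
| BoxComm (i j : int) n m : 0 < n -> 0 < m ->
    (i <= j)%R \/ ((i <= 0)%R /\ (j <= 0)%R) ->
    box_rel (letter i n ++ letter j m)
            (letter (j + n%:Z - 1)%R m ++ letter i n)
| BoxMerge (i j : int) n m : 0 < n -> 0 < m -> (0 <= j < m%:Z)%R ->
    box_rel (letter (i + j)%R n ++ letter i m) (letter i (n + m - 1)).

Inductive box_cong : word -> word -> Prop :=
| BoxRel u v : box_rel u v -> box_cong u v
| BoxRefl u : box_cong u u
| BoxSym u v : box_cong u v -> box_cong v u
| BoxTrans v u w : box_cong u v -> box_cong v w -> box_cong u w
| BoxCat u u' v v' : box_cong u u' -> box_cong v v' ->
    box_cong (u ++ v) (u' ++ v').

Definition box_eqv (u v : word) : bool := `[< box_cong u v >].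

Lemma box_eqv_refl : reflexive box_eqv.
Proof. by move=> u; apply/asboolP; exact: BoxRefl. Qed.

Lemma box_eqv_sym : symmetric box_eqv.
Proof. by move=> u v; apply/asboolP/asboolP; exact: BoxSym. Qed.

Lemma box_eqv_trans : transitive box_eqv.
Proof. by move=> v u w /asboolP ? /asboolP ?; apply/asboolP/(BoxTrans (v := v)). Qed.

Canonical box_equiv := EquivRel box_eqv box_eqv_refl box_eqv_sym box_eqv_trans.

(* The monoid with generators b_{i,n} and relations [box_rel]. *)
Definition box : Type := {eq_quot box_equiv}.
HB.instance Definition _ := Choice.on box.
HB.instance Definition _ := EqQuotient.on box.

Definition box_one : box := \pi_box [::].
Definition box_mul (x y : box) : box := \pi_box (repr x ++ repr y).

Lemma box_mul_pi u v : box_mul (\pi_box u) (\pi_box v) = \pi_box (u ++ v).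
Proof.
suff reprP w : box_cong (repr (\pi_box w)) w.
  by apply/eqmodP/asboolP/BoxCat.
by have /eqmodP/asboolP := reprK (\pi_box w).
Qed.

Lemma boxP (x : box) : exists u, x = \pi_box u.
Proof. by exists (repr x); rewrite reprK. Qed.

Lemma box_mulA : associative box_mul.
Proof.
by move=> x y z; have [[u ->] [v ->] [w ->]] := And3 (boxP x) (boxP y) (boxP z);
  rewrite !box_mul_pi catA.
Qed.

Lemma box_mul1 : left_id box_one box_mul.
Proof. by move=> x; have [u ->] := boxP x; rewrite box_mul_pi. Qed.

Lemma box_mulr1 : right_id box_one box_mul.
Proof. by move=> x; have [u ->] := boxP x; rewrite box_mul_pi cats0. Qed.

HB.instance Definition _ := isMonoid.Build box box_mulA box_mul1 box_mulr1.

(* b_{i,n}, for n >= 1 *)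
Definition box_gen (i : int) (n : nat) : box := \pi_box (letter i n).

Record endo (S : nmodType) := Endo {
  endo_fun :> S -> S;
  endoP : nmod_morphism endo_fun }.

Lemma endo_eq (S : nmodType) (f g : endo S) : f =1 g -> f = g.
Proof.
case: f g => [f Hf] [g Hg] /= /funext E.
by subst g; rewrite (Prop_irrelevance Hf Hg).
Qed.

Lemma endo_comp_subproof (S : nmodType) (f g : endo S) :
  nmod_morphism (fun s => f (g s)).
Proof.
case: f g => [f [f0 fD]] [g [g0 gD]] /=.
by split=> [|s t]; rewrite ?g0 ?f0 // gD fD.
Qed.

Definition endo_one (S : nmodType) : endo S :=
  @Endo S (fun s => s) (conj erefl (fun _ _ => erefl)).
(* Composition order: (f * g) s = f (g s). *)
Definition endo_mul (S : nmodType) (f g : endo S) : endo S :=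
  Endo (endo_comp_subproof f g).

HB.instance Definition _ (S : nmodType) := gen_eqMixin (endo S).
HB.instance Definition _ (S : nmodType) := gen_choiceMixin (endo S).

Lemma endo_mulA (S : nmodType) : associative (@endo_mul S).
Proof. by move=> f g h; apply: endo_eq. Qed.
Lemma endo_mul1 (S : nmodType) : left_id (endo_one S) (@endo_mul S).
Proof. by move=> f; apply: endo_eq. Qed.
Lemma endo_mulr1 (S : nmodType) : right_id (endo_one S) (@endo_mul S).
Proof. by move=> f; apply: endo_eq. Qed.

HB.instance Definition _ (S : nmodType) :=
  isMonoid.Build (endo S) (@endo_mulA S) (@endo_mul1 S) (@endo_mulr1 S).

(* [nmodType] is the structure of commutative monoids, written additively;
   [filt k] is the submonoid S_{k+1}. *)
Record filtMonoid := FiltMonoid {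
  fm_sort :> nmodType;
  filt : nat -> fm_sort -> Prop;
  filt_0 : forall k, filt k 0%R;
  filt_D : forall k s t, filt k s -> filt k t -> filt k (s + t)%R;
  filt_S : forall k s, filt k s -> filt k.+1 s;
  filt_cover : forall s, exists k, filt k s }.

(* [level n s] means that s belongs to S_n; meaningful for n >= 1 only. *)
Definition level (S : filtMonoid) (n : nat) : S -> Prop := filt n.-1.

Record precomp := Precomp {
  pc_base :> filtMonoid;
  pc_act : UMagmaMorphism.type box (endo pc_base);
  pc_level : forall (i : int) n m s, 0 < n -> 0 < m ->
    level m s -> level (n + m - 1) (pc_act (box_gen i n) s);
  pc_fix : forall (i : int) n m s, 0 < n -> 0 < m ->
    (m%:Z + 1 <= i)%R -> level m s -> pc_act (box_gen i n) s = s }.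

(* sigma^{i,n} *)
Definition pcop (sigma : precomp) (i : int) (n : nat) : sigma -> sigma :=
  pc_act sigma (box_gen i n).
Arguments pcop : clear implicits.

Record is_precomp_morphism (sigma tau : precomp) (phi : sigma -> tau) : Prop :=
  IsPrecompMorphism {
    pmor_nmod : nmod_morphism phi;
    pmor_level : forall n s, 0 < n -> level n s -> level n (phi s);
    pmor_op : forall i n s, 0 < n ->
      pcop tau i n (phi s) = phi (pcop sigma i n s) }.

Record precomp_morphism (sigma tau : precomp) := PrecompMorphism {
  pmor_fun :> sigma -> tau;
  pmorP : is_precomp_morphism pmor_fun }.

Lemma precomp_morphism_eq (sigma tau : precomp)
    (f g : precomp_morphism sigma tau) : f =1 g -> f = g.
Proof.
case: f g => [f Hf] [g Hg] /= /funext E.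
by subst g; rewrite (Prop_irrelevance Hf Hg).
Qed.

Lemma pmor_id_subproof (sigma : precomp) :
  is_precomp_morphism (fun s : sigma => s).
Proof. by []. Qed.

Lemma pmor_comp_subproof (sigma tau rho : precomp)
    (f : precomp_morphism tau rho) (g : precomp_morphism sigma tau) :
  is_precomp_morphism (fun s => f (g s)).
Proof.
case: f g => [f [[f0 fD] fl fo]] [g [[g0 gD] gl go]] /=.
split=> [|n s n0 Hs|i n s n0].
- by split=> [|s t]; rewrite ?g0 ?f0 // gD fD.
- by apply: fl => //; apply: gl.
- by rewrite fo // go.
Qed.

Definition pmor_id (sigma : precomp) : precomp_morphism sigma sigma :=
  PrecompMorphism (pmor_id_subproof sigma).
Definition pmor_comp (sigma tau rho : precomp)
    (f : precomp_morphism tau rho) (g : precomp_morphism sigma tau) :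
  precomp_morphism sigma rho := PrecompMorphism (pmor_comp_subproof f g).

Definition precompCat : category.
Proof.
by refine (@Category precomp precomp_morphism pmor_id pmor_comp _ _ _);
  move=> *; apply: precomp_morphism_eq.
Defined.

(* [Symbol n s _ _] is a_s^{(n)}; it is determined by n and s. *)
Record symbol (sigma : precomp) := Symbol {
  sym_arity : nat;
  sym_label : sigma;
  sym_arity_gt0 : 0 < sym_arity;
  sym_level : level sym_arity sym_label }.

Arguments Symbol {sigma} sym_arity sym_label _ _.

Lemma level_le (S : filtMonoid) n m (s : S) :
  n <= m -> level n s -> level m s.
Proof.
rewrite /level => nm; have : n.-1 <= m.-1 by rewrite -!subn1 leq_sub2r.
elim: m.-1 => [|k IH]; first by rewrite leqn0 => /eqP ->.
by rewrite leq_eqVlt => /predU1P[->//|/IH H /H]; exact: filt_S.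
Qed.

Lemma sym_comp_gt0 n m : 0 < n -> 0 < m -> 0 < n + m - 1.
Proof. by case: n m => [//|n] [//|m] _ _; rewrite addSn addnS subn1. Qed.

Lemma sym_comp_level (sigma : precomp) (x y : symbol sigma) i :
  0 < i <= sym_arity x ->
  level (sym_arity x + sym_arity y - 1)
    (pcop sigma i%:Z (sym_arity y) (sym_label x)
     + pcop sigma 0 i (sym_label y))%R.
Proof.
case: x y => [n s n0 Hs] [m t m0 Ht] /= /andP[i0 le_in].
apply: filt_D; first by rewrite addnC; exact: pc_level.
apply: (@level_le _ (i + m - 1)); first by rewrite leq_sub2r // leq_add2r.
exact: pc_level.
Qed.

Definition sym_comp (sigma : precomp) (x : symbol sigma) (i : nat)
    (y : symbol sigma) (Hi : 0 < i <= sym_arity x) : symbol sigma :=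
  Symbol (sym_arity x + sym_arity y - 1)
    (pcop sigma i%:Z (sym_arity y) (sym_label x)
     + pcop sigma 0 i (sym_label y))%R
    (sym_comp_gt0 (sym_arity_gt0 x) (sym_arity_gt0 y))
    (sym_comp_level y Hi).

Definition sym_unit (sigma : precomp) : symbol sigma :=
  Symbol 1 0%R (ltn0Sn 0) (filt_0 sigma 0).

Definition OP (sigma : precomp) : operad_data :=
  @OperadData (symbol sigma) (@sym_arity sigma) (sym_unit sigma)
    (@sym_comp sigma).

Definition OP_map (sigma tau : precomp) (phi : precomp_morphism sigma tau)
    (x : OP sigma) : OP tau :=
  Symbol (sym_arity x) (phi (sym_label x)) (sym_arity_gt0 x)
    (pmor_level (pmorP phi) (sym_arity_gt0 x) (sym_level x)).

(* Main.v *)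
From mathcomp Require Import all_boot all_order all_algebra zify.
From mathcomp Require Import boolp.
Require Import Defs.

Set Implicit Arguments.
Unset Strict Implicit.
Unset Printing Implicit Defensive.

Import GRing.Theory.
Local Open Scope quotient_scope.

(** After expanding both sides of an operad axiom with additivity, the three
    summands match one by one. Parallel associativity: commutation of the b_{i,n}
    for the first label, the fixing condition for the second (the label
    sigma^{0,i}(t) has level i + m - 1 < j + m - 1), and merging for the third.
    Sequential associativity: merging, commutation, merging. *)

Lemma box_pi_eq (u v : word) : box_cong u v -> \pi_box u = \pi_box v.
Proof. by move=> uv; apply/eqmodP/asboolP. Qed.

Section Precomposition.
Variable sigma : precomp.
Implicit Types s t : sigma.

Lemma pcop0 i n : pcop sigma i n 0%R = 0%R.
Proof. exact: (endoP (pc_act sigma (box_gen i n))).1. Qed.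

Lemma pcopD i n s t :
  pcop sigma i n (s + t)%R = (pcop sigma i n s + pcop sigma i n t)%R.
Proof. exact: (endoP (pc_act sigma (box_gen i n))).2. Qed.

(** Since [pc_act] is a monoid morphism, each defining relation between two-letter words becomes an
    identity between composites of operators. *)
Lemma pc_act_letter2 i n j m s :
  pc_act sigma (\pi_box (letter i n ++ letter j m)) s =
  pcop sigma i n (pcop sigma j m s).
Proof.
have -> : \pi_box (letter i n ++ letter j m) = (box_gen i n * box_gen j m)%g.
  by rewrite -box_mul_pi.
by rewrite gmulfM.
Qed.

Lemma pcop1 i s : pcop sigma i 1 s = s.
Proof. by rewrite /pcop /box_gen (box_pi_eq (BoxRel (BoxOne i))) gmulf1. Qed.

Lemma pcopC (i j : int) n m s : 0 < n -> 0 < m -> (i <= j)%R ->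
  pcop sigma i n (pcop sigma j m s) =
  pcop sigma (j + n%:Z - 1)%R m (pcop sigma i n s).
Proof.
move=> n0 m0 ij; rewrite -!pc_act_letter2; congr (pc_act sigma _ s).
by apply/box_pi_eq/BoxRel/BoxComm => //; left.
Qed.

Lemma pcop_merge (i j : int) n m s : 0 < n -> 0 < m -> (0 <= j < m%:Z)%R ->
  pcop sigma (i + j)%R n (pcop sigma i m s) = pcop sigma i (n + m - 1) s.
Proof.
move=> n0 m0 jm; rewrite -pc_act_letter2; congr (pc_act sigma _ s).
exact/box_pi_eq/BoxRel/BoxMerge.
Qed.

Lemma symbol_eq (x y : symbol sigma) :
  sym_arity x = sym_arity y -> sym_label x = sym_label y -> x = y.
Proof.
case: x y => [n s n0 Hs] [m t m0 Ht] /= nm st; subst m t.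
by congr Symbol; apply: Prop_irrelevance.
Qed.

Lemma OP_is_operad : is_operad (OP sigma).
Proof.
split=> //.
- exact: sym_arity_gt0.
- move=> [n s n0 Hs] [m t m0 Ht] [p u p0 Hu] i j Hi Hj ij Hj' Hi'.
  have [[i0 _] [j0 _]] := (andP Hi, andP Hj).
  apply: symbol_eq => /=; first by lia.
  rewrite !pcopD [in RHS]pcopC ?lez_nat ?(ltnW ij) //.
  (* As [0 < j], truncated subtraction on [nat] agrees with subtraction in [int]. *)
  have -> : (j%:Z + m%:Z - 1 = (j + m - 1)%N%:Z)%R by lia.
  have -> : pcop sigma (j + m - 1)%N p (pcop sigma 0 i t) = pcop sigma 0 i t.
    apply: (@pc_fix _ _ _ (i + m - 1)) => //; [lia | lia |].
    exact: pc_level.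
  (* Merging at base 0 with offset [i], which is admissible because [i < j]. *)
  have -> : pcop sigma i m (pcop sigma 0 j u) = pcop sigma 0 (j + m - 1) u.
    by rewrite -[Posz i]add0r pcop_merge ?[m + j]addnC //; lia.
  by rewrite addrAC.
- move=> [n s n0 Hs] [m t m0 Ht] [p u p0 Hu] i j Hi Hj Hij.
  have [[i0 _] [j0 /= jm]] := (andP Hi, andP Hj).
  apply: symbol_eq => /=; first by lia.
  rewrite !pcopD [in RHS]pcopC //.
  have -> : (j%:Z + i%:Z - 1 = (i + j - 1)%N%:Z)%R by lia.
  have -> : pcop sigma 0 i (pcop sigma 0 j u) = pcop sigma 0 (i + j - 1) u.
    by rewrite -[X in pcop _ X i]addr0 pcop_merge.
  (* Positions start at 1 but merge offsets at 0: the offset is [j - 1], and [1 <= j <= m] puts it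
     in the range from 0 to [m - 1]. *)
  have -> : ((i + j - 1)%N%:Z = i%:Z + (j%:Z - 1))%R by lia.
  by rewrite pcop_merge //; [rewrite addrA [m + p]addnC | lia].
- move=> [n s n0 Hs] i Hi; apply: symbol_eq => /=; first by lia.
  by rewrite pcop1 pcop0 addr0.
- move=> [n s n0 Hs] H; apply: symbol_eq => /=; first by lia.
  by rewrite pcop1 pcop0 add0r.
Qed.

End Precomposition.

Lemma OP_map_is_operad_morphism (sigma tau : precomp)
  (phi : precomp_morphism sigma tau) : is_operad_morphism (OP_map phi).
Proof.
have [[phi0 phiD] _ phi_op] := pmorP phi.
(* Preservation of the unit reduces to [phi0] on labels. *)
split=> //; first exact: symbol_eq.
move=> x y i Hi Hi'; apply: symbol_eq => //=.
have [i0 _] := andP Hi.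
by rewrite phiD !phi_op // sym_arity_gt0.
Qed.

(** The existential witnesses are proofs of propositions, so they leave no choice in the object and
    arrow maps, which are [OP] and [OP_map]. *)
Theorem claim2 :
  exists (OP_operad : forall sigma : precomp, is_operad (OP sigma))
         (OP_morphism : forall (sigma tau : precomp)
                               (phi : precomp_morphism sigma tau),
            is_operad_morphism (OP_map phi)),
    @is_functor precompCat operadCat
      (fun sigma : precomp => Operad (OP_operad sigma))
      (fun (sigma tau : precomp) (phi : precomp_morphism sigma tau) =>
         @OperadMorphism (Operad (OP_operad sigma)) (Operad (OP_operad tau))
           (OP_map phi) (OP_morphism sigma tau phi)).
Proof.
exists OP_is_operad, OP_map_is_operad_morphism.
(* Both laws hold by conversion on arities and labels; the extensionality lemmas discard the proof
   components. *)
by split=> *; apply: operad_morphism_eq => x; apply: symbol_eq.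
Qed.
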